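(* Let $D$ be a dendriform algebra. Suppose that $E$ is a vector space containing $D$ as a subspace, and $V$ is a space complement of $D$ in $E$. Then: (1) The relation $\equiv$ is an equivalence relation on the set $\mathcal{O}(D,V)$. Moreover, with $H^2(V,D):=\mathcal{O}(D,V)/\equiv$, there exists a bijection $$\Upsilon:\mathbf{Extd}(E,D)\to H^2(V,D),\qquad [(E,\succ_E,\prec_E)]\mapsto[\Omega(D,V)],$$ where $\Omega(D,V)$ is the dendriform extending structure $\Upsilon_1(E,\succ_E,\prec_E)$ and $[\cdot]$ denotes equivalence classes with respect to $\equiv$. (2) The relation $\approx$ is an equivalence relation on the set $\mathcal{O}(D,V)$. Moreover, with $H^2_V(V,D):=\mathcal{O}(D,V)/\approx$, there exists a bijection $$\Upsilon':\mathbf{Extd}'(E,D)\to H^2_V(V,D),\qquad \overline{(E,\succ_E,\prec_E)}\mapsto\overline{\Omega(D,V)},$$ where $\Omega(D,V)$ is the dendriform extending structure $\Upsilon_1(E,\succ_E,\prec_E)$ and the bar denotes equivalence classes with respect to $\approx$.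
   Context: The base field is $\mathbf{k}=\mathbb{C}$. A dendriform algebra is a vector space $D$ with bilinear operations $\succ,\prec$ such that for all $x,y,z$: $(x\succ y+x\prec y)\succ z=x\succ(y\succ z)$; $(x\prec y)\prec z=x\prec(y\succ z+y\prec z)$; $(x\succ y)\prec z=x\succ(y\prec z)$. Morphisms are linear maps preserving both operations; isomorphisms are bijective morphisms. $V$ is a space complement of $D$ in $E$ if $V$ is a subspace with $E=D+V$, $D\cap V=\{0\}$. $\mathbf{Exts}(E,D)$ is the set of all dendriform algebra structures $(E,\succ_E,\prec_E)$ on $E$ having the dendriform algebra $D$ as a subalgebra. Let $\pi:E\to V$, $\pi(a+x)=x$ ($a\in D,x\in V$). Two elements of $\mathbf{Exts}(E,D)$ are equivalent ($\equiv$) if there is an isomorphism of dendriform algebras $\psi:(E,\succ_E,\prec_E)\to(E,\succ'_E,\prec'_E)$ with $\psi(a)=a$ for all $a\in D$; they are cohomologous ($\approx$) if moreover $\psi$ can be chosen with $\pi\circ\psi=\pi$. Both are equivalence relations; $\mathbf{Extd}(E,D):=\mathbf{Exts}(E,D)/\equiv$ and $\mathbf{Extd}'(E,D):=\mathbf{Exts}(E,D)/\approx$. An extending datum of $D$ through $V$ is a system of twelve bilinear maps $\Omega(D,V)=(\triangleright_1,\triangleright_2,\triangleleft_1,\triangleleft_2,\rightharpoonup_1,\rightharpoonup_2,\leftharpoonup_1,\leftharpoonup_2,f_1,f_2,\succ_V,\prec_V)$ with $\triangleright_i:D\times V\to V$, $\triangleleft_i:V\times D\to V$, $\rightharpoonup_i:V\times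 D\to D$, $\leftharpoonup_i:D\times V\to D$, $f_i:V\times V\to D$, $\succ_V,\prec_V:V\times V\to V$. It is a dendriform extending structure if $D\times V$ with $$(a,x)\succeq(b,y):=(a\succ b+a\leftharpoonup_1 y+x\rightharpoonup_1 b+f_1(x,y),\ a\triangleright_1 y+x\triangleleft_1 b+x\succ_V y),$$ $$(a,x)\preceq(b,y):=(a\prec b+a\leftharpoonup_2 y+x\rightharpoonup_2 b+f_2(x,y),\ a\triangleright_2 y+x\triangleleft_2 b+x\prec_V y)$$ is a dendriform algebra. $\mathcal{O}(D,V)$ is the set of all dendriform extending structures of $D$ through $V$. Two dendriform extending structures $\Omega(D,V)$ and $\Omega'(D,V)$ (the latter with primed maps) are equivalent, $\Omega(D,V)\equiv\Omega'(D,V)$, if there are linear maps $g:V\to D$ and $h\in\mathrm{Aut}_{\mathbf{k}}(V)$ such that for all $a\in D$, $x,y\in V$ and $i=1,2$, writing $\bullet_1=\succ$, $\bullet_2=\prec$ on $D$, and $\bullet^V_1=\succ_V$, $\bullet^V_2=\prec_V$ (similarly $\bullet'^V_1=\succ'_V$, $\bullet'^V_2=\prec'_V$): (E1) $h(a\triangleright_i x)=a\triangleright'_i h(x)$, $h(x\triangleleft_i a)=h(x)\triangleleft'_i a$; (E2) $x\rightharpoonup_i a+g(x\triangleleft_i a)=g(x)\bullet_i a+h(x)\rightharpoonup'_i a$; (E3) $a\leftharpoonup_i x+g(a\triangleright_i x)=a\bullet_i g(x)+a\leftharpoonup'_i h(x)$; (E4) $f_i(x,y)+g(x\bullet^V_i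 y)=g(x)\bullet_i g(y)+g(x)\leftharpoonup'_i h(y)+h(x)\rightharpoonup'_i g(y)+f'_i(h(x),h(y))$; (E5) $h(x\bullet^V_i y)=g(x)\triangleright'_i h(y)+h(x)\triangleleft'_i g(y)+h(x)\bullet'^V_i h(y)$. They are cohomologous, $\Omega(D,V)\approx\Omega'(D,V)$, if this holds with $h=\mathrm{Id}_V$. Let $\rho:E\to D$, $\rho(a+x)=a$. The dendriform extending structure $\Upsilon_1(E,\succ_E,\prec_E)$ is defined, for $a\in D$, $x,y\in V$, by $a\triangleright_1x:=a\succ_Ex-\rho(a\succ_Ex)$, $x\triangleleft_1a:=x\succ_Ea-\rho(x\succ_Ea)$, $a\leftharpoonup_1x:=\rho(a\succ_Ex)$, $x\rightharpoonup_1a:=\rho(x\succ_Ea)$, $f_1(x,y):=\rho(x\succ_Ey)$, $x\succ_Vy:=x\succ_Ey-\rho(x\succ_Ey)$, and $\triangleright_2,\triangleleft_2,\leftharpoonup_2,\rightharpoonup_2,f_2,\prec_V$ by the same formulas with $\prec_E$ in place of $\succ_E$. *)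

(* Defs.v *)
From HB Require Import structures.
From mathcomp Require Import all_boot all_order all_algebra.
From mathcomp Require Import sesquilinear complex.
From mathcomp Require Import boolp classical_sets reals.
From Corelib Require Export Relation_Definitions.

Set Implicit Arguments.
Unset Strict Implicit.
Unset Printing Implicit Defensive.

Import GRing.Theory.
Local Open Scope ring_scope.

Section Quotient.
Variables (T : Type) (r : T -> T -> Prop).

Definition class_of (x : T) : set T := [set y | r x y].

(* The set T / r, as the set of the classes of r; this makes sense before r is
   known to be an equivalence relation. *)
Definition quotient : Type := {C : set T | exists x, C = class_of x}.

Definition to_quotient (x : T) : quotient :=
  exist _ (class_of x) (ex_intro _ x (erefl _)).

End Quotient.

Section Dendriform.
Variable K : fieldType.

Definition dendriform_axioms (A : lmodType K) (s p : {bilinear A -> A -> A}) :=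
  forall x y z : A,
  [/\ s (s x y + p x y) z = s x (s y z),
      p (p x y) z = p x (s y z + p y z)
    & p (s x y) z = s x (p y z)].

Record dendriform (A : lmodType K) := Dendriform {
  dsucc : {bilinear A -> A -> A};
  dprec : {bilinear A -> A -> A};
  dendriformP : dendriform_axioms dsucc dprec
}.

Definition dendriform_morphism (A B : lmodType K)
    (dA : dendriform A) (dB : dendriform B) (psi : {linear A -> B}) : Prop :=
  (forall x y, psi (dsucc dA x y) = dsucc dB (psi x) (psi y)) /\
  (forall x y, psi (dprec dA x y) = dprec dB (psi x) (psi y)).

Definition dendriform_isomorphism (A B : lmodType K)
    (dA : dendriform A) (dB : dendriform B) (psi : {linear A -> B}) : Prop :=
  dendriform_morphism dA dB psi /\ bijective psi.

End Dendriform.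

Section ExtendingStructures.
Variables (K : fieldType) (D V : lmodType K) (dD : dendriform D).

(* An extending datum consists of two families of six bilinear maps, with
   indices 1 (going with succ) and 2 (going with prec). *)
Record cross_maps := CrossMaps {
  rtri  : {bilinear D -> V -> V};
  ltri  : {bilinear V -> D -> V};
  rharp : {bilinear V -> D -> D};
  lharp : {bilinear D -> V -> D};
  cocyc : {bilinear V -> V -> D};
  vmul  : {bilinear V -> V -> V}
}.

Record extending_datum := ExtendingDatum {
  maps1 : cross_maps;
  maps2 : cross_maps
}.

Definition unified_op (op : {bilinear D -> D -> D}) (O : cross_maps)
    (u v : (D * V)%type) : (D * V)%type :=
  let: (a, x) := u in
  let: (b, y) := v in
  (op a b + lharp O a y + rharp O x b + cocyc O x y,
   rtri O a y + ltri O x b + vmul O x y).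

Lemma unified_op_bilinear op O :
  bilinear_for ( *:%R : K -> _ -> _) ( *:%R : K -> _ -> _) (unified_op op O).
Proof.
split=> [[b y]|[b y]] k [a x] [a' x'] /=;
  apply/pair_equal_spec; split; rewrite /= ?linearPl ?linearPr !scalerDr.
all: do 3?[rewrite [RHS]addrACA; congr (_ + _)].
Qed.

HB.instance Definition _ op O :=
  bilinear_isBilinear.Build K (D * V)%type (D * V)%type (D * V)%type
    *:%R *:%R (unified_op op O) (unified_op_bilinear op O).

Definition usucc (O : extending_datum) :
    {bilinear (D * V)%type -> (D * V)%type -> (D * V)%type} :=
  unified_op (dsucc dD) (maps1 O).

Definition uprec (O : extending_datum) :
    {bilinear (D * V)%type -> (D * V)%type -> (D * V)%type} :=
  unified_op (dprec dD) (maps2 O).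

Definition extending_structure : Type :=
  {O : extending_datum | dendriform_axioms (usucc O) (uprec O)}.

(* The conditions relating the maps of one index, op being the corresponding
   operation of D; they express that (a, x) |-> (a + g x, h x) commutes with
   the operations unified_op op O and unified_op op O' of D x V. *)
Definition cross_compatible (op : {bilinear D -> D -> D}) (O O' : cross_maps)
    (g : {linear V -> D}) (h : {linear V -> V}) : Prop :=
  forall (a : D) (x y : V),
  [/\ h (rtri O a x) = rtri O' a (h x) /\ h (ltri O x a) = ltri O' (h x) a,
      rharp O x a + g (ltri O x a) = op (g x) a + rharp O' (h x) a,
      lharp O a x + g (rtri O a x) = op a (g x) + lharp O' a (h x),
      cocyc O x y + g (vmul O x y) =
        op (g x) (g y) + lharp O' (g x) (h y) + rharp O' (h x) (g y)
        + cocyc O' (h x) (h y)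
    & h (vmul O x y) =
        rtri O' (g x) (h y) + ltri O' (h x) (g y) + vmul O' (h x) (h y)].

Definition datum_compatible (O O' : extending_datum)
    (g : {linear V -> D}) (h : {linear V -> V}) : Prop :=
  cross_compatible (dsucc dD) (maps1 O) (maps1 O') g h /\
  cross_compatible (dprec dD) (maps2 O) (maps2 O') g h.

Definition structure_equiv (O O' : extending_structure) : Prop :=
  exists (g : {linear V -> D}) (h : {linear V -> V}),
    bijective h /\ datum_compatible (sval O) (sval O') g h.

Definition structure_cohom (O O' : extending_structure) : Prop :=
  exists g : {linear V -> D}, datum_compatible (sval O) (sval O') g idfun.

Definition H2 : Type := quotient structure_equiv.
Definition H2_V : Type := quotient structure_cohom.

End ExtendingStructures.

Section BilinearComp.
Variables (K : fieldType) (A B E W : lmodType K).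
Variables (p : {linear E -> W}) (i : {linear A -> E}) (j : {linear B -> E}).
Variable op : {bilinear E -> E -> E}.

Definition bilinear_comp (u : A) (v : B) : W := p (op (i u) (j v)).

Lemma bilinear_comp_bilinear :
  bilinear_for ( *:%R : K -> _ -> _) ( *:%R : K -> _ -> _) bilinear_comp.
Proof.
by split=> [v|v] k u u'; rewrite /= /bilinear_comp linearP ?linearPl ?linearPr linearP.
Qed.

HB.instance Definition _ :=
  bilinear_isBilinear.Build K A B W *:%R *:%R bilinear_comp
    bilinear_comp_bilinear.

End BilinearComp.

Section Extensions.
Variables (K : fieldType) (E : lmodType K).

Definition space_complement (SD SV : pred E) : Prop :=
  (forall e : E, exists a x : E, [/\ a \in SD, x \in SV & e = a + x]) /\
  (forall e : E, e \in SD -> e \in SV -> e = 0).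

(* D and V are the types of the elements of E satisfying SD and SV, embedded in
   E by val; a subLmodType structure forces these predicates to be subspaces. *)
Variables (SD SV : pred E) (D : subLmodType SD) (V : subLmodType SV).
Variable dD : dendriform D.

Definition Exts : Type :=
  {dE : dendriform E |
    (forall a b : D, dsucc dE (val a) (val b) = val (dsucc dD a b)) /\
    (forall a b : D, dprec dE (val a) (val b) = val (dprec dD a b))}.

Definition Exts_equiv (s s' : Exts) : Prop :=
  exists psi : {linear E -> E},
    dendriform_isomorphism (sval s) (sval s') psi /\
    forall a : D, psi (val a) = val a.

Definition Extd : Type := quotient Exts_equiv.

Variable hDV : space_complement SD SV.

Lemma rho_subproof (e : E) : exists a : D, e - val a \in SV.
Proof.
have [a [x [aD xV ->]]] := hDV.1 e.
by exists (Sub a aD); rewrite SubK addrC addKr.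
Qed.

Definition rho (e : E) : D := xchoose (rho_subproof e).

Definition piV (e : E) : V := Sub (e - val (rho e)) (xchooseP (rho_subproof e)).

Lemma rho_piV (e : E) : val (rho e) + val (piV e) = e.
Proof. by rewrite SubK addrC subrK. Qed.

Lemma sum_inj (a b : D) (x y : V) :
  val a + val x = val b + val y -> a = b /\ x = y.
Proof.
move=> eqab.
have eqd : val a - val b = val y - val x.
  by apply/eqP; rewrite subr_eq addrAC eq_sym subr_eq eqab addrC.
have d0 : val a - val b = 0.
  apply: hDV.2; first by rewrite -raddfB; apply: valP.
  by rewrite eqd -raddfB; apply: valP.
split; apply: val_inj; first by apply/eqP; rewrite -subr_eq0 d0.
by apply/esym/eqP; rewrite -subr_eq0 -eqd d0.
Qed.

Lemma rhoE (a : D) (x : V) : rho (val a + val x) = a.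
Proof. by case: (sum_inj (rho_piV (val a + val x))). Qed.

Lemma piVE (a : D) (x : V) : piV (val a + val x) = x.
Proof. by case: (sum_inj (rho_piV (val a + val x))). Qed.

Lemma rho_piV_linear k e e' :
  rho (k *: e + e') = k *: rho e + rho e' /\
  piV (k *: e + e') = k *: piV e + piV e'.
Proof.
apply: sum_inj; rewrite rho_piV !raddfD /= !linearZ /= addrACA -scalerDr.
by rewrite !rho_piV.
Qed.

Lemma rho_linear : linear rho.
Proof. by move=> k e e'; case: (rho_piV_linear k e e'). Qed.

Lemma piV_linear : linear piV.
Proof. by move=> k e e'; case: (rho_piV_linear k e e'). Qed.

HB.instance Definition _ := GRing.isLinear.Build K E D *:%R rho rho_linear.
HB.instance Definition _ := GRing.isLinear.Build K E V *:%R piV piV_linear.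

Definition Exts_cohom (s s' : Exts) : Prop :=
  exists psi : {linear E -> E},
    [/\ dendriform_isomorphism (sval s) (sval s') psi,
        forall a : D, psi (val a) = val a
      & forall e : E, piV (psi e) = piV e].

Definition Extd' : Type := quotient Exts_cohom.

(* By definition of piV, the V-valued maps are of the form
   (u, v) |-> op u v - rho (op u v). *)
Definition Upsilon1_maps (op : {bilinear E -> E -> E}) : cross_maps D V :=
  let inD : {linear D -> E} := val in
  let inV : {linear V -> E} := val in
  {| rtri  := bilinear_comp piV inD inV op;
     ltri  := bilinear_comp piV inV inD op;
     rharp := bilinear_comp rho inV inD op;
     lharp := bilinear_comp rho inD inV op;
     cocyc := bilinear_comp rho inV inV op;
     vmul  := bilinear_comp piV inV inV op |}.

Definition Upsilon1_datum (dE : dendriform E) : extending_datum D V :=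
  {| maps1 := Upsilon1_maps (dsucc dE); maps2 := Upsilon1_maps (dprec dE) |}.

Let phi (u : (D * V)%type) : E := val u.1 + val u.2.

Lemma phi_unified_op (opD : {bilinear D -> D -> D}) (op : {bilinear E -> E -> E})
    (hop : forall a b : D, op (val a) (val b) = val (opD a b)) u v :
  phi (unified_op opD (Upsilon1_maps op) u v) = op (phi u) (phi v).
Proof.
case: u v => [a x] [b y]; rewrite /phi /= /bilinear_comp /=.
rewrite linearDl !linearDr /= hop.
rewrite !raddfD /= -!addrA; congr (_ + _).
rewrite -[in RHS](rho_piV (op (val a) (val y))).
rewrite -[in RHS](rho_piV (op (val x) (val b))).
rewrite -[in RHS](rho_piV (op (val x) (val y))).
set r1 := val (rho _); set r2 := val (rho _); set r3 := val (rho _).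
set p1 := val (piV _); set p2 := val (piV _); set p3 := val (piV _).
by rewrite (addrACA r2) (addrACA r1) -!addrA.
Qed.

Let phi_inj : injective phi.
Proof. by case=> [a x] [b y] /sum_inj[/= -> ->]. Qed.

Lemma Upsilon1_subproof (s : Exts) :
  dendriform_axioms (usucc dD (Upsilon1_datum (sval s)))
    (uprec dD (Upsilon1_datum (sval s))).
Proof.
case: s => dE [hs hp] u v w; rewrite [sval _]/=.
have phiD (u1 u2 : (D * V)%type) : phi (u1 + u2) = phi u1 + phi u2.
  by rewrite /phi /= !raddfD /= addrACA.
have phis u1 u2 : phi (usucc dD (Upsilon1_datum dE) u1 u2)
    = dsucc dE (phi u1) (phi u2) by exact: phi_unified_op.
have phip u1 u2 : phi (uprec dD (Upsilon1_datum dE) u1 u2)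
    = dprec dE (phi u1) (phi u2) by exact: phi_unified_op.
have [e1 e2 e3] := dendriformP dE (phi u) (phi v) (phi w).
by split; apply: phi_inj; rewrite !(phis, phip, phiD).
Qed.

Definition Upsilon1 (s : Exts) : extending_structure V dD :=
  exist _ (Upsilon1_datum (sval s)) (Upsilon1_subproof s).

End Extensions.

Arguments structure_equiv {K D V} dD O O'.
Arguments structure_cohom {K D V} dD O O'.
Arguments extending_structure {K D} V dD.
Arguments H2 {K D} V dD.
Arguments H2_V {K D} V dD.
Arguments Exts {K E SD D} dD.
Arguments Exts_equiv {K E SD D} dD s s'.
Arguments Extd {K E SD D} dD.
Arguments Exts_cohom {K E SD SV D} V dD hDV s s'.
Arguments Extd' {K E SD SV D} V dD hDV.
Arguments Upsilon1 {K E SD SV D} V dD hDV s.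

(* Main.v *)
Require Import Defs.
From HB Require Import structures.
From mathcomp Require Import all_boot all_order all_algebra.
From mathcomp Require Import sesquilinear complex boolp classical_sets reals.
From Corelib Require Import Relation_Definitions.

(** Write E as the direct sum of D and V.  The isomorphism (a, x) |-> a + x
    from D x V to E carries an extension of D on E to a unified product on
    D x V whose components are the maps Upsilon1, and every extending structure
    arises in this way from the structure that it transports to E.  Thus
    Upsilon1 is onto on the nose (Upsilon1_transport), before any passage to
    classes.

    A linear endomorphism psi of E that fixes D pointwise is determined by its
    values on V, hence by the two components g : V -> D and h : V -> V of its
    restriction to V, through psi (a + x) = (a + g x) + h x.  Evaluating the
    compatibility of psi with the operations on a + x and b + y, and separating
    the terms according to whether each argument lies in D or in V, gives
    exactly the identities of cross_compatible for (g, h) (cross_compatibleP and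
    block_isomorphismP); psi is bijective exactly when h is
    (bijective_block), and psi preserves the projection to V exactly when h is
    the identity.  So two extensions are equivalent (cohomologous) if and only
    if their images under Upsilon1 are.

    Equivalence and cohomology of extensions are equivalence relations because
    isomorphisms can be composed and inverted.  A surjection that both preserves
    and reflects relations transports this property to extending structures,
    so that composites and inverses of pairs (g, h) need never be written down,
    and it induces the bijections on quotients. *)

Set Implicit Arguments.
Unset Strict Implicit.
Unset Printing Implicit Defensive.

Import GRing.Theory.
Local Open Scope ring_scope.

(** * Quotients by relations *)

Section Quotient.
Variables (T : Type) (r : T -> T -> Prop).

Lemma quotient_ind (P : quotient r -> Prop) :
  (forall x, P (to_quotient r x)) -> forall q, P q.
Proof.
move=> Pcls [C Cex]; have [x defC] := Cex.
suff -> : exist _ C Cex = to_quotient r x by exact: Pcls.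
exact: eq_exist.
Qed.

Lemma to_quotient_eqP (r_equiv : equivalence T r) x y :
  to_quotient r x = to_quotient r y <-> r x y.
Proof.
case: r_equiv => rr rt rs; split=> [/(congr1 sval) /= eq_cl | rxy].
  have: class_of r y y by exact: rr.
  by rewrite -eq_cl.
apply: eq_exist; rewrite predeqE => z; split; last exact: rt.
exact/rt/rs.
Qed.

End Quotient.

Lemma quotient_map (T U : Type) (r : T -> T -> Prop) (r' : U -> U -> Prop)
    (f : T -> U) :
  equivalence T r -> equivalence U r' ->
  (forall x y, r x y -> r' (f x) (f y)) ->
  exists F : quotient r -> quotient r',
    forall x, F (to_quotient r x) = to_quotient r' (f x).
Proof.
move=> r_equiv r'_equiv f_homo.
exists (fun q : quotient r => to_quotient r' (f (projT1 (cid (svalP q))))) => x.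
case: cid => y eq_cl; apply/to_quotient_eqP => //; apply: f_homo.
by apply/to_quotient_eqP => //; apply: eq_exist.
Qed.

(** A map that preserves and reflects relations is injective on classes; its
    right inverse g preserves relations for the same reason, hence is the
    inverse on classes. *)
Section SurjectiveEmbedding.
Variables (T U : Type) (r : T -> T -> Prop) (r' : U -> U -> Prop).
Variables (f : T -> U) (g : U -> T).
Hypotheses (gK : cancel g f) (f_mono : forall x y, r x y <-> r' (f x) (f y)).
Hypothesis r_equiv : equivalence T r.

Lemma equivalence_transport : equivalence U r'.
Proof.
case: r_equiv => rr rt rs.
have r'E u v : r' u v <-> r (g u) (g v) by rewrite f_mono !gK.
split=> [u | u v w | u v]; rewrite !r'E; [exact: rr | exact: rt | exact: rs].
Qed.

Lemma quotient_bijection :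
  exists F : quotient r -> quotient r',
    bijective F /\ forall x, F (to_quotient r x) = to_quotient r' (f x).
Proof.
have r'_equiv := equivalence_transport.
have [F FE] : exists F : quotient r -> quotient r',
    forall x, F (to_quotient r x) = to_quotient r' (f x).
  by apply: quotient_map => // x y /f_mono.
have [G GE] : exists G : quotient r' -> quotient r,
    forall u, G (to_quotient r' u) = to_quotient r (g u).
  by apply: quotient_map => // u v; rewrite f_mono !gK.
exists F; split=> //; exists G.
  apply: quotient_ind => x.
  by rewrite FE GE; apply/to_quotient_eqP => //; rewrite f_mono gK; case: r'_equiv.
by apply: quotient_ind => u; rewrite GE FE gK.
Qed.

End SurjectiveEmbedding.

(** * Morphisms of unified products *)

Lemma bilinear_ext (K : fieldType) (A B C : lmodType K)
    (f g : {bilinear A -> B -> C}) : f =2 g -> f = g.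
Proof.
move=> eq_fg; have {eq_fg} : f = g :> (A -> B -> C).
  by apply: funext => a; apply: funext => b.
case: f g => f [[f1 f2 f3 f4]] [g [[g1 g2 g3 g4]]] /= eq_fg.
subst g; congr (Bilinear.Pack (Bilinear.Class _)).
by congr isBilinear.Axioms_; apply: Prop_irrelevance.
Qed.

Section CrossCompatible.
Variables (K : fieldType) (D V : lmodType K).
Variables (op : {bilinear D -> D -> D}) (O O' : cross_maps D V).
Variables (g : {linear V -> D}) (h : {linear V -> V}).

Definition block_map (u : (D * V)%type) : (D * V)%type := (u.1 + g u.2, h u.2).

Lemma block_map_linear : linear block_map.
Proof.
move=> k u v; apply/pair_equal_spec; split; rewrite /= !linearP //=.
by rewrite scalerDr addrACA.
Qed.

HB.instance Definition _ :=
  GRing.isLinear.Build K (D * V)%type (D * V)%type *:%R block_map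
    block_map_linear.

(** Both sides are biadditive, so they agree as soon as they agree on pairs of
    elements of D or V.  The case of two elements of D is trivial; the two
    components give the conditions on lharp and rtri for a pair in D x V, on
    rharp and ltri for a pair in V x D, on cocyc and vmul for a pair in V x V. *)
Lemma cross_compatibleP :
  cross_compatible op O O' g h <->
  forall u v, block_map (unified_op op O u v)
              = unified_op op O' (block_map u) (block_map v).
Proof.
pose zeros := (linear0, linear0l, linear0r, addr0, add0r).
split=> [comp [a x] [b y] | morph a x y].
  have pairE (c : D) (z : V) : (c, z) = (c, 0) + (0, z) :> (D * V)%type.
    by apply/pair_equal_spec; rewrite /= addr0 add0r.
  rewrite (pairE a) (pairE b) !(linearDl, linearDr, linearD).
  have [[rtriE _] _ lharpE _ _] := comp a y x.
  have [[_ ltriE] rharpE _ _ _] := comp b x y.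
  have [_ _ _ cocycE vmulE] := comp a x y.
  congr (_ + _ + (_ + _)); rewrite /= /block_map /= ?zeros //.
  - by rewrite rtriE lharpE.
  - by rewrite ltriE rharpE.
  - by rewrite cocycE vmulE.
have := morph (0, x) (0, y).
have := morph (0, x) (a, 0); have := morph (a, 0) (0, x).
rewrite /block_map /= !zeros.
by case=> lharpE rtriE [rharpE ltriE] [cocycE vmulE]; split.
Qed.

End CrossCompatible.

(** * Isomorphisms of dendriform algebras *)

Section Isomorphisms.
Variable K : fieldType.

Lemma dendriform_isomorphism_id (A : lmodType K) (dA : dendriform A) :
  dendriform_isomorphism dA dA idfun.
Proof. by split=> //; exists id. Qed.

Lemma dendriform_isomorphism_comp (A B C : lmodType K) (dA : dendriform A)
    (dB : dendriform B) (dC : dendriform C)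
    (psi : {linear A -> B}) (psi' : {linear B -> C}) :
  dendriform_isomorphism dA dB psi -> dendriform_isomorphism dB dC psi' ->
  dendriform_isomorphism dA dC (psi' \o psi).
Proof.
move=> [[psis psip] psi_bij] [[psis' psip'] psi'_bij].
split; last exact: bij_comp.
by split=> x y; rewrite /= (psis, psip) (psis', psip').
Qed.

Lemma dendriform_isomorphism_inv (A B : lmodType K) (dA : dendriform A)
    (dB : dendriform B) (psi : {linear A -> B}) :
  dendriform_isomorphism dA dB psi ->
  exists psi' : {linear B -> A},
    [/\ cancel psi psi', cancel psi' psi & dendriform_isomorphism dB dA psi'].
Proof.
move=> [[psis psip] [inv psiK invK]].
have inv_lin : linear inv by exact: can2_linear psiK invK.
pose inv_isLinear := GRing.isLinear.Build K B A *:%R inv inv_lin.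
pose psi' : {linear B -> A} := HB.pack inv inv_isLinear.
exists psi'; split=> //; split; last by exists psi.
by split=> x y; apply: (can_inj psiK); rewrite /= (psis, psip) !invK.
Qed.

(** Isomorphisms subject to a condition stable under identity, composition and
    inversion form a groupoid, whose connected components are the classes of an
    equivalence relation; P is the set of structures under consideration. *)
Lemma isomorphism_equivalence (E : lmodType K) (P : dendriform E -> Prop)
    (Q : (E -> E) -> Prop) (r : sig P -> sig P -> Prop) :
  Q id -> (forall f f', Q f -> Q f' -> Q (f' \o f)) ->
  (forall f f', Q f -> cancel f f' -> cancel f' f -> Q f') ->
  (forall s s', r s s' <-> exists psi : {linear E -> E},
     dendriform_isomorphism (sval s) (sval s') psi /\ Q psi) ->
  equivalence (sig P) r.
Proof.
move=> Qid Qcomp Qinv rE; split=> [s | s s' s'' | s s']; rewrite !rE.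
- by exists idfun; split=> //; apply: dendriform_isomorphism_id.
- move=> [psi [iso Qpsi]] [psi' [iso' Qpsi']]; exists (psi' \o psi).
  by split; [apply: dendriform_isomorphism_comp iso' | apply: Qcomp].
- move=> [psi [/dendriform_isomorphism_inv [psi' [psiK psi'K iso]] Qpsi]].
  by exists psi'; split=> //; apply: Qinv psiK psi'K.
Qed.

End Isomorphisms.

(** * Extensions and extending structures *)

Section Extensions.
Variables (K : fieldType) (E : lmodType K) (SD SV : pred E).
Variables (D : subLmodType SD) (V : subLmodType SV) (dD : dendriform D).
Hypothesis hDV : space_complement SD SV.

Local Notation rho := (rho D hDV).
Local Notation piV := (piV D V hDV).
Local Notation Upsilon1 := (Upsilon1 V dD hDV).

Definition DV_sum (u : (D * V)%type) : E := val u.1 + val u.2.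

Definition DV_split (e : E) : (D * V)%type := (rho e, piV e).

Lemma DV_sum_linear : linear DV_sum.
Proof.
by move=> k [a x] [b y]; rewrite /DV_sum /= !linearP /= scalerDr addrACA.
Qed.

Lemma DV_split_linear : linear DV_split.
Proof. by move=> k e e'; apply/pair_equal_spec; split; exact: linearP. Qed.

HB.instance Definition _ :=
  GRing.isLinear.Build K (D * V)%type E *:%R DV_sum DV_sum_linear.
HB.instance Definition _ :=
  GRing.isLinear.Build K E (D * V)%type *:%R DV_split DV_split_linear.

Lemma DV_sumK : cancel DV_sum DV_split.
Proof. by case=> a x; rewrite /DV_split rhoE piVE. Qed.

Lemma rho_DV_sum u : rho (DV_sum u) = u.1.
Proof. exact: rhoE. Qed.

Lemma piV_DV_sum u : piV (DV_sum u) = u.2.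
Proof. exact: piVE. Qed.

Lemma DV_splitK : cancel DV_split DV_sum.
Proof. exact: rho_piV. Qed.

Lemma DV_sum_l (a : D) : DV_sum (a, 0) = val a.
Proof. by rewrite /DV_sum /= raddf0 addr0. Qed.

Lemma DV_sum_r (x : V) : DV_sum (0, x) = val x.
Proof. by rewrite /DV_sum /= raddf0 add0r. Qed.

Definition transport_op
    (op : {bilinear (D * V)%type -> (D * V)%type -> (D * V)%type}) :
    {bilinear E -> E -> E} :=
  bilinear_comp DV_sum DV_split DV_split op.

Lemma transport_op_D (op : {bilinear D -> D -> D}) (O : cross_maps D V) a b :
  transport_op (unified_op op O) (val a) (val b) = val (op a b).
Proof.
rewrite /= /bilinear_comp -!DV_sum_l /= !(rho_DV_sum, piV_DV_sum) /=.
by rewrite !(linear0l, linear0r, addr0).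
Qed.

(** Each of the six maps is a component of the operation on D x V at a pair of
    elements of D or V, where the other terms of the unified product vanish. *)
Lemma Upsilon1_maps_transport (op : {bilinear D -> D -> D}) (O : cross_maps D V) :
  Upsilon1_maps D V hDV (transport_op (unified_op op O)) = O.
Proof.
case: O => rtri ltri rharp lharp cocyc vmul.
congr CrossMaps; apply: bilinear_ext => u v; rewrite /= /bilinear_comp /=.
all: rewrite /bilinear_comp -?(DV_sum_l, DV_sum_r) /= !(rho_DV_sum, piV_DV_sum) /=.
all: by rewrite !(linear0l, linear0r, addr0, add0r).
Qed.

Section Transport.
Variable O : extending_structure V dD.

Lemma transport_axioms :
  dendriform_axioms (transport_op (usucc dD (sval O)))
                    (transport_op (uprec dD (sval O))).
Proof.
move=> x y z; have [e1 e2 e3] := svalP O (DV_split x) (DV_split y) (DV_split z).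
have opE op : transport_op op =2 fun e e' => DV_sum (op (DV_split e) (DV_split e')).
  by [].
by split; rewrite !opE -?linearD !DV_sumK ?e1 ?e2 ?e3.
Qed.

Definition transport : Exts dD :=
  exist _ (Dendriform transport_axioms)
    (conj (transport_op_D (dsucc dD) (maps1 (sval O)))
          (transport_op_D (dprec dD) (maps2 (sval O)))).

End Transport.

Lemma Upsilon1_transport : cancel transport Upsilon1.
Proof.
case=> [[O1 O2] axO]; apply: eq_exist.
by rewrite /= /Upsilon1_datum /= /usucc /uprec !Upsilon1_maps_transport.
Qed.

(** * Endomorphisms of E fixing D pointwise *)

Section Block.
Variables (psi : {linear E -> E}) (g : {linear V -> D}) (h : {linear V -> V}).
Hypothesis psiE : forall u, psi (DV_sum u) = DV_sum (block_map g h u).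

Lemma block_fix (a : D) : psi (val a) = val a.
Proof. by rewrite -DV_sum_l psiE /block_map /= !linear0 addr0. Qed.

Lemma block_piV (e : E) : piV (psi e) = h (piV e).
Proof. by rewrite -{1}(DV_splitK e) psiE piV_DV_sum. Qed.

(** With respect to D + V the map psi is upper triangular with diagonal blocks
    the identity and h. *)
Lemma bijective_block : bijective psi <-> bijective h.
Proof.
split=> [[psi' psiK psi'K] | [h' hK h'K]].
  have h'K : cancel (fun y => piV (psi' (val y))) h.
    by move=> y; rewrite -block_piV psi'K -DV_sum_r piV_DV_sum.
  exists (fun y => piV (psi' (val y))) => //; apply: inj_can_sym h'K _.
  (* If h x = h y, then psi sends the two pairs below to the same element. *)
  move=> x y eq_h; suff: (0, x) = (g x - g y, y) :> (D * V)%type by case.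
  apply/(can_inj DV_sumK)/(can_inj psiK).
  by rewrite !psiE /block_map /= add0r subrK eq_h.
(* The inverse of the block matrix (1 g; 0 h) is (1 -g h'; 0 h'). *)
pose inv_block (u : (D * V)%type) := (u.1 - g (h' u.2), h' u.2).
exists (fun e => DV_sum (inv_block (DV_split e))) => e.
  rewrite -{1}(DV_splitK e) psiE DV_sumK /inv_block /block_map /= hK addrK.
  exact: DV_splitK.
rewrite psiE /inv_block /block_map /= h'K subrK; exact: DV_splitK.
Qed.

Lemma block_morph_op (opD : {bilinear D -> D -> D})
    (op op' : {bilinear E -> E -> E}) :
  (forall a b : D, op (val a) (val b) = val (opD a b)) ->
  (forall a b : D, op' (val a) (val b) = val (opD a b)) ->
  (forall e e', psi (op e e') = op' (psi e) (psi e')) <->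
  cross_compatible opD (Upsilon1_maps D V hDV op) (Upsilon1_maps D V hDV op') g h.
Proof.
move=> opE op'E; rewrite cross_compatibleP.
have sumM u v : DV_sum (unified_op opD (Upsilon1_maps D V hDV op) u v)
    = op (DV_sum u) (DV_sum v) by exact: phi_unified_op.
have sumM' u v : DV_sum (unified_op opD (Upsilon1_maps D V hDV op') u v)
    = op' (DV_sum u) (DV_sum v) by exact: phi_unified_op.
split=> [morph u v | morph e e'].
  by apply: (can_inj DV_sumK); rewrite -psiE sumM morph sumM' -!psiE.
by rewrite -(DV_splitK e) -(DV_splitK e') -sumM !psiE morph sumM'.
Qed.

Lemma block_isomorphismP (s s' : Exts dD) :
  dendriform_isomorphism (sval s) (sval s') psi <->
  bijective h /\ datum_compatible dD (sval (Upsilon1 s)) (sval (Upsilon1 s')) g h.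
Proof.
case: s s' => dE [hs hp] [dE' [hs' hp']].
rewrite /dendriform_isomorphism /dendriform_morphism /datum_compatible /=.
rewrite (block_morph_op hs hs') (block_morph_op hp hp') bijective_block.
by split=> -[].
Qed.

End Block.

Definition D_component (psi : {linear E -> E}) : {linear V -> D} :=
  fst \o DV_split \o psi \o val.

Definition V_component (psi : {linear E -> E}) : {linear V -> V} :=
  snd \o DV_split \o psi \o val.

(** The second component is a parameter h, given up to pointwise equality, so
    that it can be the identity itself when psi preserves the projection. *)
Lemma block_decomposition (psi : {linear E -> E}) (h : {linear V -> V}) :
  (forall a : D, psi (val a) = val a) -> V_component psi =1 h ->
  forall u, psi (DV_sum u) = DV_sum (block_map (D_component psi) h u).
Proof.
move=> psiD psiV [a x]; rewrite /DV_sum /block_map /= -psiV /= raddfD /= psiD.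
by rewrite raddfD /= -addrA rho_piV.
Qed.

Definition block_endo (g : {linear V -> D}) (h : {linear V -> V}) :
    {linear E -> E} :=
  DV_sum \o block_map g h \o DV_split.

Lemma block_endoE g h u : block_endo g h (DV_sum u) = DV_sum (block_map g h u).
Proof. by rewrite /= DV_sumK. Qed.

(** * Equivalence and cohomology *)

Lemma Exts_equiv_equivalence : equivalence (Exts dD) (Exts_equiv dD).
Proof.
apply: (isomorphism_equivalence (Q := fun f => forall a : D, f (val a) = val a)).
- by [].
- by move=> f f' fD f'D a; rewrite /= fD f'D.
- by move=> f f' fD fK f'K a; rewrite -{1}fD fK.
- by [].
Qed.

Lemma Exts_cohom_equivalence : equivalence (Exts dD) (Exts_cohom V dD hDV).
Proof.
apply: (isomorphism_equivalence (Q := fun f =>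
  (forall a : D, f (val a) = val a) /\ (forall e, piV (f e) = piV e))).
- by [].
- move=> f f' [fD fV] [f'D f'V].
  by split=> [a | e] /=; rewrite ?fD ?f'D ?f'V ?fV.
- move=> f f' [fD fV] fK f'K.
  by split=> [a | e]; [rewrite -{1}fD fK | rewrite -fV f'K].
- by move=> s s'; split=> -[psi] => [[? ? ?] | [? []]]; exists psi.
Qed.

Lemma Exts_equivP (s s' : Exts dD) :
  Exts_equiv dD s s' <-> structure_equiv dD (Upsilon1 s) (Upsilon1 s').
Proof.
split=> [[psi [iso psiD]] | [g [h comp]]].
  exists (D_component psi), (V_component psi).
  by apply/(block_isomorphismP (block_decomposition psiD (frefl _))).
have psiE := block_endoE g h.
exists (block_endo g h); split; last exact: block_fix psiE.
exact/(block_isomorphismP psiE).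
Qed.

Lemma Exts_cohomP (s s' : Exts dD) :
  Exts_cohom V dD hDV s s' <-> structure_cohom dD (Upsilon1 s) (Upsilon1 s').
Proof.
split=> [[psi [iso psiD psiV]] | [g comp]].
  have V_id : V_component psi =1 idfun.
    by move=> x; rewrite -[LHS]/(piV (psi (val x))) psiV -DV_sum_r piV_DV_sum.
  have psiE := block_decomposition (h := idfun) psiD V_id.
  by exists (D_component psi); have [] := (block_isomorphismP psiE s s').1 iso.
have psiE := block_endoE g idfun.
exists (block_endo g idfun); split; [|exact: block_fix psiE|exact: block_piV psiE].
by apply/(block_isomorphismP psiE); split=> //; exists id.
Qed.

End Extensions.

Local Open Scope complex_scope.

Theorem theorem3p15 (R : realType) (E : lmodType R[i]) (SD SV : pred E)
    (D : subLmodType SD) (dD : dendriform D) (V : subLmodType SV)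
    (hDV : space_complement SD SV) :
  (equivalence (extending_structure V dD) (structure_equiv dD) /\
   exists Upsilon : Extd dD -> H2 V dD,
     bijective Upsilon /\
     forall s : Exts dD,
       Upsilon (to_quotient (Exts_equiv dD) s) =
       to_quotient (structure_equiv dD) (Upsilon1 V dD hDV s)) /\
  (equivalence (extending_structure V dD) (structure_cohom dD) /\
   exists Upsilon' : Extd' V dD hDV -> H2_V V dD,
     bijective Upsilon' /\
     forall s : Exts dD,
       Upsilon' (to_quotient (Exts_cohom V dD hDV) s) =
       to_quotient (structure_cohom dD) (Upsilon1 V dD hDV s)).
Proof.
have onto := @Upsilon1_transport _ _ _ _ _ V dD hDV.
have equivP := @Exts_equivP _ _ _ _ _ V dD hDV.
have cohomP := @Exts_cohomP _ _ _ _ _ V dD hDV.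
have equivE := Exts_equiv_equivalence dD.
have cohomE := Exts_cohom_equivalence V dD hDV.
split; split.
- exact: equivalence_transport onto equivP equivE.
- exact: quotient_bijection onto equivP equivE.
- exact: equivalence_transport onto cohomP cohomE.
- exact: quotient_bijection onto cohomP cohomE.
Qed.
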